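(* Let $X$ be a normal Hausdorff topological space, $\Phi$ a local semiflow on $X$, and $\mathscr{A}$ an attractor of $\Phi$. Suppose $\mathscr{A}$ has an admissible neighborhood $N_1$. Then any attractor $A$ of $\Phi$ in $\mathscr{A}$ (i.e. any attractor of the restricted global semiflow $\Phi|_{\mathscr{A}}$ on $\mathscr{A}$) is also an attractor of $\Phi$ in $X$.
   Context: Setting: $X$ is a normal Hausdorff topological space and $\Phi$ is a local semiflow on $X$ (a continuous map from an open set $\mathcal{D}_\Phi\subset\mathbb{R}^+\times X$ to $X$, with escape times $T_x\in(0,\infty]$, $\Phi(0)x=x$, and $\Phi(t+s)x=\Phi(t)\Phi(s)x$). A set $U$ is a neighborhood of $A$ if $\overline{A}\subset\operatorname{int}U$. A set $M$ attracts $B$ if $T_x=\infty$ for all $x\in B$ and for every neighborhood $V$ of $M$ there is $t_0>0$ with $\Phi(t)B\subset V$ for all $t>t_0$. A set is sequentially compact (s-compact) if every sequence in it has a subsequence converging to a point of the set. An attractor of $\Phi$ is a nonempty s-compact invariant set $\mathscr{A}$ for which there is a neighborhood $N$ of $\mathscr{A}$ such that $\mathscr{A}$ attracts $N$ and $\mathscr{A}$ is the maximal s-compact invariant set in $N$. Since $\mathscr{A}$ is invariant, the restriction $\Phi|_{\mathscr{A}}$ is a global semiflow on $\mathscr{A}$; a set $A\subset\mathscr{A}$ is called an attractor of $\Phi$ in $\mathscr{A}$ if it is an attractor of $\Phi|_{\mathscr{A}}$ (with $\mathscr{A}$ carrying the subspace topology). A set $M$ is admissible if for any sequences $x_n\in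 M$ and $t_n\to\infty$ with $\Phi([0,t_n])x_n\subset M$ for all $n$, the sequence $\Phi(t_n)x_n$ has a convergent subsequence. *)

(* Defs.v *)
From HB Require Import structures.
From mathcomp Require Import all_boot all_order all_algebra.
From mathcomp Require Import all_classical all_reals all_analysis.
Set Implicit Arguments. Unset Strict Implicit. Unset Printing Implicit Defensive.
Import Order.TTheory GRing.Theory Num.Theory numFieldNormedType.Exports.
Local Open Scope classical_set_scope.
Local Open Scope ring_scope.

Section semiflows.
Context {R : realType} {X : topologicalType}.

(* A local semiflow is given by a (total) function Phi : R -> X -> X together
   with escape times T : X -> \bar R; its domain is
   D_Phi = {(t,x) | 0 <= t < T x} ; outside D_Phi, Phi is irrelevant. *)
Definition sf_dom (T : X -> \bar R) : set (R * X) :=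
  [set p | 0 <= p.1 /\ (p.1%:E < T p.2)%E].

Definition local_semiflow (Phi : R -> X -> X) (T : X -> \bar R) : Prop :=
  [/\ (forall x, (0 < T x)%E),
      (exists O : set (R * X), open O /\ sf_dom T = [set p | 0 <= p.1] `&` O),
      {within sf_dom T, continuous (fun p => Phi p.1 p.2)},
      (forall x, Phi 0 x = x) &
      (forall x t s, 0 <= t -> 0 <= s -> ((t + s)%:E < T x)%E ->
          (t%:E < T (Phi s x))%E /\ Phi (t + s) x = Phi t (Phi s x))].

Definition nbhd_of (A U : set X) : Prop := closure A `<=` U°.

Definition s_compact (M : set X) : Prop :=
  forall u : nat -> X, (forall n, M (u n)) ->
    exists (phi : nat -> nat) (x : X),
      {homo phi : m n / (m < n)%N >-> (m < n)%N} /\ M x /\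
      (u \o phi) @ \oo --> x.

Definition invariant (Phi : R -> X -> X) (T : X -> \bar R) (M : set X) :=
  (forall x, M x -> T x = +oo%E) /\ (forall t, 0 <= t -> Phi t @` M = M).

Definition attracts (Phi : R -> X -> X) (T : X -> \bar R) (M B : set X) :=
  (forall x, B x -> T x = +oo%E) /\
  (forall V, nbhd_of M V ->
     exists t0, 0 < t0 /\ forall t, t0 < t -> Phi t @` B `<=` V).

Definition attractor (Phi : R -> X -> X) (T : X -> \bar R) (A : set X) :=
  [/\ A !=set0, s_compact A, invariant Phi T A &
      exists N, [/\ nbhd_of A N, attracts Phi T A N &
        forall B, B `<=` N -> s_compact B -> invariant Phi T B -> B `<=` A]].

Definition admissible (Phi : R -> X -> X) (T : X -> \bar R) (M : set X) :=
  forall (x : nat -> X) (t : nat -> R),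
    (forall n, M (x n)) -> t @ \oo --> +oo ->
    (forall n s, 0 <= s <= t n -> (s%:E < T (x n))%E /\ M (Phi s (x n))) ->
    exists (phi : nat -> nat) (y : X),
      {homo phi : m n / (m < n)%N >-> (m < n)%N} /\
      (fun n => Phi (t (phi n)) (x (phi n))) @ \oo --> y.

End semiflows.

(* Restriction of Phi to a set Acal, as a semiflow on the subspace
   [set_type Acal] (sigma type with the subspace = initial topology).
   The value is only meaningful when Acal is invariant and t >= 0. *)
Definition restr_sf {R : realType} {X : topologicalType} (Phi : R -> X -> X)
  (Acal : set X) : R -> set_type Acal -> set_type Acal :=
  fun t y => insubd y (Phi t (set_val y)).

Definition restr_T {R : realType} {X : topologicalType} (T : X -> \bar R)
  (Acal : set X) : set_type Acal -> \bar R := fun y => T (set_val y).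
Arguments restr_sf {R X} Phi Acal _ _.
Arguments restr_T {R X} T Acal _.

(* Main.v *)
Require Import Defs.
From HB Require Import structures.
From mathcomp Require Import all_boot all_order all_algebra.
From mathcomp Require Import all_classical all_reals all_analysis.
From mathcomp Require Import lra.
Import Order.TTheory GRing.Theory Num.Theory numFieldNormedType.Exports.
Local Open Scope classical_set_scope.
Local Open Scope ring_scope.

(** Let [K] be the ambient attractor, attracting a neighborhood [N].
   Admissibility makes every sequence [Phi t_n x_n] with [x_n] in [N] and
   [t_n] tending to infinity subconvergent; the set of all such limits is
   invariant and sequentially compact, hence contained in [K] by maximality.
   Let [A] be an attractor in [K], attracting [Q `&` K] with [Q] open. Neither
   [A] nor [K] need be closed, so [closure A] may leave [Q]; but its limits lie
   in [closure A `&` K], so [closure A] enters [Q] after a finite time [t0], and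
   [Q' := N `&` (Phi t0)^-1 Q] is a neighborhood of [A] with [Q' `&` K]
   attracted by [A]. By normality pick a neighborhood [W] of [A] with [closure W] in [Q'],
   and let [U n] be the set of points whose orbit stays in [W] up to time [n].
   If each [U n] contained an orbit leaving [W], the exit points would
   accumulate at a point [Phi s z] outside the interior of [W] with [z] in
   [closure W `&` K] and [s] as large as we wish, contradicting the attraction
   in [K]. So some [U n] stays in [W] forever, and the same argument shows that
   [A] attracts it. *)

(** * Subsequences, divergence to infinity and exit times *)

Lemma homo_ltn_ge_id (phi : nat -> nat) :
  {homo phi : m n / (m < n)%N >-> (m < n)%N} -> forall n, (n <= phi n)%N.
Proof.
move=> hphi; elim=> // n IH; exact: leq_ltn_trans IH (hphi _ _ (ltnSn n)).
Qed.

Lemma cvg_homo_ltn (phi : nat -> nat) :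
  {homo phi : m n / (m < n)%N >-> (m < n)%N} -> phi @ \oo --> \oo.
Proof.
move=> /homo_ltn_ge_id hphi; apply/cvgnyPge => m.
exists m => // n /= mn; exact: leq_trans (hphi n).
Qed.

Lemma cvgr_pinfty_ge_nat {R : realType} (t : nat -> R) :
  (forall n, n%:R <= t n) -> t @ \oo --> +oo.
Proof.
move=> ht; apply/cvgryPge => a; near=> n.
apply: le_trans (ht n); near: n; exact: nbhs_infty_ger.
Unshelve. all: by end_near. Qed.

Lemma cvgr_pinfty_shift {R : realType} (t : nat -> R) (s : R) :
  t @ \oo --> +oo -> (fun n => t n - s) @ \oo --> +oo.
Proof.
move=> /cvgryPge ht; apply/cvgryPge => a.
by apply: filterS (ht (a + s)) => n; rewrite lerBrDr.
Qed.

(** The infimum of the failure times need not be a failure time, so [t] is only taken within 1 of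
    it; hence the bound [t - 1]. *)
Lemma exists_near_first_exit {R : realType} (P : R -> Prop) (b : R) :
  (forall t, 0 <= t <= b -> P t) -> ~ (forall t, 0 <= t -> P t) ->
  exists t, [/\ b <= t, ~ P t & forall s, 0 <= s <= t - 1 -> P s].
Proof.
move=> Pb /existsNP[t1 /not_implyP[t10 nPt1]].
pose E := [set t | 0 <= t /\ ~ P t].
have lbE : lbound E 0 by move=> t [].
have infE : has_inf E by split; [exists t1|exists 0].
have [t [t0 nPt] tlt] := inf_adherent ltr01 infE.
exists t; split=> //.
  by rewrite leNgt; apply/negP => tb; apply/nPt/Pb; rewrite t0 ltW.
move=> s /andP[s0 st]; apply: contrapT => nPs.
have : inf E <= s by apply: ge_inf; [exists 0|].
lra.
Qed.

(** * Neighborhood forms of the continuity of a local semiflow *)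

Section local_semiflow_theory.
Context {R : realType} {X : topologicalType}.
Variables (Phi : R -> X -> X) (T : X -> \bar R).
Hypothesis sfPhi : local_semiflow Phi T.

Lemma semiflow0 x : Phi 0 x = x. Proof. by case: sfPhi. Qed.

Lemma semiflowD x t s : T x = +oo%E -> 0 <= t -> 0 <= s ->
  Phi (t + s) x = Phi t (Phi s x).
Proof.
by case: sfPhi => _ _ _ _ h Tx t0 s0; case: (h x t s t0 s0); rewrite ?Tx ?ltry.
Qed.

(** Relative openness of the domain turns continuity within it into a full neighborhood in the
    product, guarded by [0 <= p.1]. *)
Lemma semiflow_near x t V : 0 <= t -> T x = +oo%E -> nbhs (Phi t x) V ->
  \forall p \near (t, x), 0 <= p.1 -> V (Phi p.1 p.2).
Proof.
case: sfPhi => _ [D0 [oD0 domE]] /subspace_continuousP ct _ _ t0 Tx nV.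
have D : sf_dom T (t, x) by split; rewrite //= Tx ltry.
have D0tx : D0 (t, x) by move: D; rewrite domE => -[].
have := ct _ D _ nV; rewrite /nbhs/= /within => nW.
have nD0 : nbhs (t, x) D0 by exact: open_nbhs_nbhs.
apply: filterS2 nD0 nW => p D0p Wp p0; apply: Wp.
by rewrite domE.
Qed.

Lemma semiflow_continuous x t : 0 <= t -> T x = +oo%E ->
  Phi t y @[y --> x] --> Phi t x.
Proof.
move=> t0 Tx V nV; have [[A B] /= [nA nB] AB] := semiflow_near _ _ _ t0 Tx nV.
apply: filterS nB => y By; apply: (AB (t, y)) => //; split=> //.
exact: nbhs_singleton.
Qed.

Lemma semiflow_tube x b W : T x = +oo%E ->
  (forall t, 0 <= t <= b -> nbhs (Phi t x) W) ->
  \forall y \near x, forall t, 0 <= t <= b -> W (Phi t y).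
Proof.
move=> Tx nW; have /compact_near_coveringP cov := @segment_compact R 0 b.
(* The guard [0 <= s] is there because neighborhoods of time 0 contain negative times. *)
have H : \forall y \near x, `[0, b] `<=` (fun s => 0 <= s -> W (Phi s y)).
  apply: (cov _ (nbhs x) (fun y s => 0 <= s -> W (Phi s y))) => t /=.
  rewrite in_itv/= => tb.
  have /andP[t0 _] := tb.
  exact: (semiflow_near _ _ _ t0 Tx (nW t tb)).
apply: filterS H => y Hy t tb; apply: Hy; last by case/andP: tb.
by rewrite /= in_itv.
Qed.

End local_semiflow_theory.

(** * Omega-limit sets near an attractor with an admissible neighborhood *)

Section attractor_with_admissible_neighborhood.
Context {R : realType} {X : topologicalType}.
Variables (Phi : R -> X -> X) (T : X -> \bar R) (K N N1 : set X).
Hypotheses (hX : hausdorff_space X) (nX : normal_space X).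
Hypothesis sfPhi : local_semiflow Phi T.
Hypotheses (nbKN : nbhd_of K N) (attrKN : attracts Phi T K N).
Hypothesis maxK : forall B, B `<=` N -> s_compact B ->
  Defs.invariant Phi T B -> B `<=` K.
Hypotheses (nbKN1 : nbhd_of K N1) (admN1 : admissible Phi T N1).

Let TN x : N x -> T x = +oo%E. Proof. by case: attrKN => h _; exact: h. Qed.

(** [G] inside [N1] gives access to admissibility, while [closure G] inside [N] keeps limits where
    orbits are global. *)
Lemma absorbing_subset : exists (G : set X) (tau : R),
  [/\ 0 <= tau, closure G `<=` N, G `<=` N1 &
      forall t x, tau <= t -> N x -> G (Phi t x)].
Proof.
have [|G nG clG] := nX _ (@closed_closure _ K) (N `&` N1).
  by move=> x clx; apply: filterI; [exact: nbKN|exact: nbKN1].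
have [|t0 [t0gt0 Ht0]] := attrKN.2 G.
  by move=> x clx; exact: nG.
(* Attraction holds for times strictly beyond [t0], hence the added 1. *)
exists G, (t0 + 1); split.
- lra.
- by move=> x /clG[].
- by move=> x /subset_closure /clG[].
- move=> t x tt Nx; apply: (Ht0 t); [lra|by exists x].
Qed.

(** Sequential, since admissibility yields limits of sequences only; the base points may vary with
    [n]. *)
Definition omega_limit (B : set X) : set X :=
  [set y | exists (x : nat -> X) (t : nat -> R),
    [/\ forall n, B (x n), t @ \oo --> +oo &
        (fun n => Phi (t n) (x n)) @ \oo --> y]].

Lemma omega_limit_sub : omega_limit N `<=` N.
Proof.
have [G [tau [tau0 GN _ HG]]] := absorbing_subset.
move=> y [x [t [Nx /cvgryPge tinf cv]]]; apply: GN.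
apply: (closed_cvg (closure G) (@closed_closure _ G) _ _ cv).
by apply: filterS (tinf tau) => n tn; apply: subset_closure; exact: HG.
Qed.

(** Orbits restarted at time [tau] stay in [N1], so admissibility applies with the times
    [t n - tau]. *)
Lemma flow_convergent_subsequence (x : nat -> X) (t : nat -> R) :
  (forall n, N (x n)) -> t @ \oo --> +oo ->
  exists (phi : nat -> nat) (y : X),
    [/\ {homo phi : m n / (m < n)%N >-> (m < n)%N}, omega_limit N y &
        (fun n => Phi (t (phi n)) (x (phi n))) @ \oo --> y].
Proof.
have [G [tau [tau0 GN GN1 HG]]] := absorbing_subset.
move=> Nx tinf.
have [||n s /andP[s0 sn]|phi [y [hphi cv]]] :=
    admN1 (fun n => Phi tau (x n)) (fun n => t n - tau).
- by move=> n; apply/GN1/HG.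
- exact: cvgr_pinfty_shift.
- split.
    by rewrite TN ?ltry//; apply/GN/subset_closure/HG.
  by rewrite -(semiflowD _ _ sfPhi) ?TN//; apply/GN1/HG => //; lra.
have cvt : (fun n => t (phi n)) @ \oo --> +oo.
  exact: cvg_comp (cvg_homo_ltn _ hphi) tinf.
have cvy : (fun n => Phi (t (phi n)) (x (phi n))) @ \oo --> y.
  apply: cvg_trans cv; apply: near_eq_cvg.
  move/cvgryPge : cvt => /(_ tau); apply: filterS => n tn /=.
  by rewrite -(semiflowD _ _ sfPhi) ?TN ?subrK// subr_ge0.
exists phi, y; split=> //.
by exists (x \o phi), (t \o phi); split=> // n; exact: Nx.
Qed.

(** [z] is a limit of the orbits taken [s] earlier; continuity of [Phi s] and uniqueness of limits
    give [Phi s z = y]. *)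
Lemma flow_limit_pull_back (x : nat -> X) (t : nat -> R) (y : X) (s : R) :
  (forall n, N (x n)) -> t @ \oo --> +oo ->
  (fun n => Phi (t n) (x n)) @ \oo --> y -> 0 <= s ->
  exists (phi : nat -> nat) (z : X),
    [/\ {homo phi : m n / (m < n)%N >-> (m < n)%N}, omega_limit N z,
        Phi s z = y & (fun n => Phi (t (phi n) - s) (x (phi n))) @ \oo --> z].
Proof.
move=> Nx tinf cv s0.
have [phi [z [hphi oz cvz]]] :=
  flow_convergent_subsequence _ _ Nx (cvgr_pinfty_shift _ s tinf).
exists phi, z; split=> //.
have Tz : T z = +oo%E by apply/TN/omega_limit_sub.
have cvphi := cvg_homo_ltn _ hphi.
apply: (cvg_unique hX (F := (fun n => Phi (t (phi n)) (x (phi n))) @ \oo)).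
  have := cvg_comp _ _ cvz (semiflow_continuous _ _ sfPhi _ _ s0 Tz).
  apply: cvg_trans; apply: near_eq_cvg.
  have /cvgryPge/(_ s) : (t \o phi) @ \oo --> +oo by exact: cvg_comp cvphi tinf.
  apply: filterS => n tn /=.
  by rewrite -(semiflowD _ _ sfPhi) ?TN ?subr_ge0// addrC subrK.
exact: (cvg_comp _ _ cvphi cv).
Qed.

Lemma omega_limit_invariant : Defs.invariant Phi T (omega_limit N).
Proof.
split=> [x /omega_limit_sub /TN //|s s0]; apply/seteqP; split=> [_ [y oy <-]|y].
  have Ty : T y = +oo%E by apply/TN/omega_limit_sub.
  case: oy => x [t [Nx tinf cv]].
  (* The double negation fits a forward shift to [cvgr_pinfty_shift]. *)
  exists x, (fun n => t n - (- s)); split=> //; first exact: cvgr_pinfty_shift.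
  have := cvg_comp _ _ cv (semiflow_continuous _ _ sfPhi _ _ s0 Ty).
  apply: cvg_trans; apply: near_eq_cvg.
  move/cvgryPge : tinf => /(_ 0); apply: filterS => n tn /=.
  by rewrite -(semiflowD _ _ sfPhi) ?TN// opprK addrC.
move=> [x [t [Nx tinf cv]]].
have [phi [z [_ oz zy _]]] := flow_limit_pull_back _ _ _ _ Nx tinf cv s0.
by exists z.
Qed.

(* Invariance lets y_n be written as Phi n z_n, so that admissibility applies
   to the sequence y itself and no diagonal argument (hence no first
   countability) is needed. *)
Lemma omega_limit_s_compact : s_compact (omega_limit N).
Proof.
move=> y oy.
have /choice[z Hz] : forall n, exists z, omega_limit N z /\ Phi n%:R z = y n.
  move=> n; have := oy n.
  rewrite -{1}(omega_limit_invariant.2 n%:R (ler0n _ _)) => -[z oz zy].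
  by exists z.
have [||phi [w [hphi ow cv]]] := flow_convergent_subsequence z (fun n => n%:R).
- by move=> n; apply: omega_limit_sub; case: (Hz n).
- exact: cvgr_pinfty_ge_nat.
exists phi, w; split=> //; split=> //.
apply: cvg_trans cv; apply: near_eq_cvg; apply: nearW => n /=.
by case: (Hz (phi n)).
Qed.

Lemma omega_limit_sub_attractor : omega_limit N `<=` K.
Proof.
by apply: maxK; [exact: omega_limit_sub|exact: omega_limit_s_compact
                |exact: omega_limit_invariant].
Qed.

(** Otherwise points outside [V], reached at times beyond every [n], subconverge to a point of
    [omega_limit B]. *)
Lemma eventually_uniformly_in (B V : set X) : B `<=` N ->
  (forall y, omega_limit B y -> nbhs y V) ->
  exists t0, 0 < t0 /\ forall t x, t0 <= t -> B x -> V (Phi t x).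
Proof.
move=> BN HV; apply: contrapT => /forallNP noV.
have /choice[p Hp] : forall n : nat, exists p : R * X,
    [/\ n%:R + 1 <= p.1, B p.2 & ~ V (Phi p.1 p.2)].
  move=> n; apply: contrapT => /forallNP noP; apply: (noV (n%:R + 1)).
  split=> [|t x tn Bx]; first by rewrite ltr_wpDl.
  by apply: contrapT => nV; apply: (noP (t, x)); split.
have Bp n : B (p n).2 by case: (Hp n).
have tinf : (fun n => (p n).1) @ \oo --> +oo.
  by apply: cvgr_pinfty_ge_nat => n; case: (Hp n) => + _ _; lra.
have [phi [y [hphi _ cv]]] :=
  flow_convergent_subsequence (fun n => (p n).2) _ (fun n => BN _ (Bp n)) tinf.
have oy : omega_limit B y.
  exists (fun n => (p (phi n)).2), (fun n => (p (phi n)).1); split=> //.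
  exact: cvg_comp (cvg_homo_ltn _ hphi) tinf.
have [n _ /(_ n (leqnn n))/=] := cv _ (HV _ oy).
by case: (Hp (phi n)).
Qed.

Hypothesis invK : Defs.invariant Phi T K.

(** The hypotheses express within [X] that [A] is an attractor in [K], the trace of [Q] on [K] being
    the attracted neighborhood. *)
Lemma attractor_of_attractor_in (A Q : set X) :
  A !=set0 -> s_compact A -> Defs.invariant Phi T A -> A `<=` K ->
  open Q -> closure A `&` K `<=` Q ->
  (forall V, nbhd_of A V -> exists t0, 0 < t0 /\
     forall t x, t0 < t -> K x -> Q x -> V (Phi t x)) ->
  (forall B, B `<=` K `&` Q -> s_compact B -> Defs.invariant Phi T B ->
     B `<=` A) ->
  attractor Phi T A.
Proof.
move=> A0 cA invA AK oQ clAQ attrQ maxQ.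
pose C := closure A.
have CN : C `<=` N by move=> c /(closure_subset AK)/nbKN/interior_subset.
have C_forward t c : 0 <= t -> C c -> C (Phi t c).
  move=> t0 Cc V nV.
  have ct := semiflow_continuous _ _ sfPhi _ _ t0 (TN _ (CN _ Cc)).
  have [a [Aa Va]] := Cc _ (ct _ nV).
  by exists (Phi t a); split=> //; rewrite -(invA.2 t t0); exists a.
have K_forward t z : 0 <= t -> K z -> K (Phi t z).
  by move=> t0 Kz; rewrite -(invK.2 t t0); exists z.
(* C need not lie in K, hence not in Q, but it enters Q after a finite time. *)
have [t0 [t0_gt0 CQ]] : exists t0, 0 < t0 /\
    forall t x, t0 <= t -> C x -> Q (Phi t x).
  apply: eventually_uniformly_in => // y [x [t [Cx tinf cv]]].
  apply: open_nbhs_nbhs; split=> //; apply: clAQ; split.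
    apply: (closed_cvg C (@closed_closure _ A) _ _ cv).
    move/cvgryPge : tinf => /(_ 0); apply: filterS => n tn.
    exact: C_forward.
  apply: omega_limit_sub_attractor; exists x, t; split=> // n; exact: CN.
pose Q' := N `&` Phi t0 @^-1` Q.
have [|W nW clW] := nX C (@closed_closure _ A) Q'.
  move=> c Cc; apply: filterI.
    by have /nbKN := closure_subset AK Cc.
  apply: (semiflow_continuous _ _ sfPhi _ _ (ltW t0_gt0) (TN _ (CN _ Cc))).
  by apply: open_nbhs_nbhs; split=> //; exact: CQ.
have WQ' : W `<=` Q' by move=> x Wx; apply/clW/subset_closure.
(* Points of [Q'] in [K] reach [Q] at time [t0], then wait more than [t1]. The bound [1 <= s0]
   serves to skip the last unit of time, where [W] is not controlled. *)
have attrQ' V : nbhd_of A V -> exists s0, 1 <= s0 /\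
    forall s z, s0 <= s -> K z -> Q' z -> V (Phi s z).
  move=> nV; have [t1 [t1_gt0 Ht1]] := attrQ V nV.
  exists (t0 + t1 + 1); split=> [|s z ss Kz [Nz Qz]]; first lra.
  have -> : s = s - t0 + t0 by rewrite subrK.
  rewrite (semiflowD _ _ sfPhi) ?TN//; [|lra|lra].
  by apply: Ht1 => //; [lra|apply: K_forward => //; lra].
have limit_in V x t (y : X) : nbhd_of A V -> (forall n, N (x n)) ->
    t @ \oo --> +oo -> (fun n => Phi (t n) (x n)) @ \oo --> y ->
    (forall n s, 0 <= s <= t n - 1 -> W (Phi s (x n))) -> nbhs y V.
  move=> nV Nx tinf cv xW.
  have [|s0 [s0_ge1 Hs0]] := attrQ' V°.
    by move=> c /nV /nbhs_interior.
  have s0_ge0 : 0 <= s0 by lra.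
  (* Going back by [s0] puts [z] in both [closure W] and [K], where the attraction applies. *)
  have [phi [z [hphi oz zy cvz]]] :=
    flow_limit_pull_back _ _ _ _ Nx tinf cv s0_ge0.
  rewrite -zy; apply: Hs0 => //; first exact: omega_limit_sub_attractor.
  apply: clW; apply: (closed_cvg (closure W) (@closed_closure _ W) _ _ cvz).
  have /cvgryPge/(_ s0) : (t \o phi) @ \oo --> +oo.
    exact: cvg_comp (cvg_homo_ltn _ hphi) tinf.
  apply: filterS => n /= tn; apply/subset_closure/xW; apply/andP; split; lra.
pose U (n : nat) := [set x | forall t, 0 <= t <= n%:R -> W (Phi t x)].
have UW n x : U n x -> W x.
  by move=> /(_ 0); rewrite (semiflow0 _ _ sfPhi); apply; rewrite lexx ler0n.
have UN n : U n `<=` N by move=> x /UW /WQ'[].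
have nU n : nbhd_of A (U n).
  move=> c Cc; apply: semiflow_tube sfPhi _ _ _ (TN _ (CN _ Cc)) _ => t.
  move=> /andP[t_ge0 _]; exact/nW/C_forward.
have [m Um] : exists m, forall x t, U m x -> 0 <= t -> W (Phi t x).
  apply: contrapT => /forallNP noU.
  have /choice[p Hp] : forall n : nat, exists p : R * X,
      [/\ U n p.2, n%:R <= p.1, ~ W (Phi p.1 p.2) &
          forall s, 0 <= s <= p.1 - 1 -> W (Phi s p.2)].
    move=> n; have /existsNP[x Hx] := noU n.
    have Ux : U n x by apply: contrapT => nUx; apply: Hx => t /nUx.
    have [|t [nt nWt Wt]] :=
        exists_near_first_exit (fun t => W (Phi t x)) n%:R Ux.
      by move=> Wx; apply: Hx => t _; exact: Wx.
    by exists (t, x); split.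
  have Np n : N (p n).2 by case: (Hp n) => /UN.
  have tinf : (fun n => (p n).1) @ \oo --> +oo.
    by apply: cvgr_pinfty_ge_nat => n; case: (Hp n).
  have [phi [y [hphi _ cv]]] := flow_convergent_subsequence _ _ Np tinf.
  (* [W] is itself a neighborhood of [A], so the limit of the exit points is interior to [W], which
     they all avoid. *)
  have nyW : nbhs y W.
    apply: (limit_in W (fun n => (p (phi n)).2) (fun n => (p (phi n)).1)) => //.
    - exact: cvg_comp (cvg_homo_ltn _ hphi) tinf.
    - by move=> n; case: (Hp (phi n)).
  have [n _ /(_ n (leqnn n))/=] := cv _ nyW.
  by case: (Hp (phi n)).
split=> //; exists (U m); split=> //.
  split=> [x /UN/TN//|V nV].
  have [|s0 [s0_gt0 Hs0]] := eventually_uniformly_in (U m) V (UN m).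
    move=> y [x [t [Ux tinf cv]]]; apply: (limit_in V x t) => //.
      by move=> n; exact: UN (Ux n).
    by move=> n s /andP[s_ge0 _]; exact: Um.
  exists s0; split=> // t ts _ [x Ux <-].
  by apply: Hs0 => //; exact: ltW.
move=> B BU cB invB; have BK : B `<=` K.
  by apply: maxK => // x /BU/UN.
apply: maxQ => // x Bx; split; first exact: BK.
(* Membership in [Q'] only controls the image under [Phi t0]; invariance writes each point of [B] as
   such an image. *)
move: Bx; rewrite -{1}(invB.2 _ (ltW t0_gt0)) => -[z Bz <-].
by have /UW /WQ'[] := BU _ Bz.
Qed.

End attractor_with_admissible_neighborhood.

(** * Transfer between the subspace and the ambient space *)

Section restriction.
Context {R : realType} {X : topologicalType}.
Variables (Phi : R -> X -> X) (T : X -> \bar R) (K : set X).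
Hypothesis invK : Defs.invariant Phi T K.

Lemma closure_set_val (A : set (set_type K)) (y : set_type K) :
  closure A y <-> closure (set_val @` A) (set_val y).
Proof.
split=> [cly V nV|cly V].
  have [a [Aa Va]] := cly _ (@initial_continuous _ _ (@set_val _ K) y _ nV).
  by exists (set_val a); split=> //; exists a.
move=> [_ [[B oB <-] By BV]].
have [_ [[a Aa <-] Ba]] := cly B (open_nbhs_nbhs (conj oB By)).
by exists a; split=> //; exact: BV.
Qed.

Lemma cvg_set_val (u : nat -> set_type K) (y : set_type K) :
  (set_val \o u) @ \oo --> set_val y <-> u @ \oo --> y.
Proof.
split=> [cv V [_ [[B oB <-] By BV]]|cv].
  have nB : nbhs (set_val y) B by exact: open_nbhs_nbhs.
  by have [m _ Hm] := cv _ nB; exists m => // n mn; exact/BV/(Hm n mn).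
exact: cvg_comp cv (@initial_continuous _ _ (@set_val _ K) y).
Qed.

(** Invariance of [K] ensures that the default value of [insubd] is never taken. *)
Lemma restr_sf_val t (y : set_type K) : 0 <= t ->
  set_val (restr_sf Phi K t y) = Phi t (set_val y).
Proof.
move=> t0; apply: insubdK; apply/mem_set.
have /seteqP[imK _] := invK.2 t t0.
by apply: imK; exists (set_val y) => //; exact: set_valP.
Qed.

Lemma s_compact_set_val (A : set (set_type K)) :
  s_compact A <-> s_compact (set_val @` A).
Proof.
split=> cA u uA.
  have /choice[v Hv] : forall n, exists v, A v /\ set_val v = u n.
    by move=> n; have [v] := uA n; exists v.
  have [|phi [x [hphi [Ax cv]]]] := cA v; first by move=> n; case: (Hv n).
  exists phi, (set_val x); split=> //; split; first by exists x.
  have -> : u = set_val \o v by apply/funext => n; case: (Hv n).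
  exact/cvg_set_val.
have [|phi [_ [hphi [[x Ax <-] cv]]]] := cA (set_val \o u).
  by move=> n; exists (u n).
by exists phi, x; split=> //; split=> //; exact/cvg_set_val.
Qed.

Lemma invariant_set_val (A : set (set_type K)) :
  Defs.invariant (restr_sf Phi K) (restr_T T K) A <->
  Defs.invariant Phi T (set_val @` A).
Proof.
have imE t : 0 <= t ->
    Phi t @` (set_val @` A) = set_val @` (restr_sf Phi K t @` A).
  move=> t0; rewrite !image_comp.
  by apply: eq_imagel => y _ /=; rewrite restr_sf_val.
split=> -[TA invA]; split.
- by move=> _ [y Ay <-]; exact: TA.
- by move=> t t0; rewrite imE// invA.
- by move=> y Ay; apply: TA; exists y.
- move=> t t0; have := invA t t0; rewrite imE// => /seteqP[sub1 sub2].
  apply/seteqP; split=> y Ay.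
    by have [|z Az /val_inj <-] := sub1 (set_val y); first by exists y.
  by have [|z Az /val_inj <-] := sub2 (set_val y); first by exists y.
Qed.

End restriction.

Theorem theorem6p1 (R : realType) (X : topologicalType)
  (Phi : R -> X -> X) (T : X -> \bar R) (Acal N1 : set X) :
  hausdorff_space X -> normal_space X ->
  local_semiflow Phi T ->
  attractor Phi T Acal ->
  nbhd_of Acal N1 -> admissible Phi T N1 ->
  forall A : set (set_type Acal),
    attractor (restr_sf Phi Acal) (restr_T T Acal) A ->
    attractor Phi T (set_val @` A).
Proof.
move=> hX nX sfPhi [_ _ invK [N [nbKN attrKN maxK]]] nbKN1 admN1 A.
move=> [A0 cA invA [N' [nbAN' [_ attrN'] maxN']]].
(* Open sets of the subspace are traces of open sets of [X], which provides [Q]. *)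
have [Q oQ QN'] : open (N'° : set (set_type Acal)) by exact: open_interior.
apply: (attractor_of_attractor_in _ _ _ _ _ hX nX sfPhi nbKN attrKN maxK
  nbKN1 admN1 invK _ Q) => //.
- by case: A0 => a Aa; exists (set_val a), a.
- exact/s_compact_set_val.
- exact/invariant_set_val.
- by move=> _ [y _ <-]; exact: set_valP.
- move=> x [clx Kx]; have := nbAN' (SigSub (mem_set Kx)).
  by rewrite -QN'; apply; exact/closure_set_val.
- move=> V nV; have [|t0 [t0_gt0 Ht0]] := attrN' (set_val @^-1` V).
    move=> y /closure_set_val /nV nVy.
    exact: (@initial_continuous _ _ (@set_val _ Acal) y _ nVy).
  exists t0; split=> // t x tt Kx Qx.
  have t_ge0 : 0 <= t by rewrite ltW// (lt_trans t0_gt0).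
  rewrite -[x]/(set_val (SigSub (mem_set Kx))) -(restr_sf_val _ _ _ invK)//.
  apply: (Ht0 t tt); exists (SigSub (mem_set Kx)) => //.
  apply: (@interior_subset _ N'); rewrite -QN'; exact: Qx.
- move=> B BKQ cB invB.
  have valB : set_val @` ((@set_val _ Acal) @^-1` B) = B.
    apply/seteqP; split=> [_ [y By <-]//|x Bx].
    by have [Kx _] := BKQ _ Bx; exists (SigSub (mem_set Kx)).
  rewrite -valB; apply: image_subset; apply: maxN'.
  + by move=> y /BKQ[_ Qy]; apply: (@interior_subset _ N'); rewrite -QN'.
  + by apply/s_compact_set_val; rewrite valB.
  + by apply/(invariant_set_val _ _ _ invK); rewrite valB.
Qed.
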